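(* Let $m$ be a positive integer and $\lambda$ a nonzero real number. For integers $n\ge k\ge0$, $$V_{m,\lambda}(n,k)=\sum_{j=k}^{n}\sum_{l=k}^{j}\binom{l}{k}(-1)^{l-k}\langle 1\rangle_{l-k,\lambda}\left(\sum_{i=l}^{j}S_{1,\lambda}(i,l)S_{2}(j,i)\right)S_{1}(n,j)\,m^{n-j}.$$
   Context: For a nonzero real $\lambda$: $(x)_{0,\lambda}=1$, $(x)_{n,\lambda}=x(x-\lambda)\cdots(x-(n-1)\lambda)$; $\langle x\rangle_{0,\lambda}=1$, $\langle x\rangle_{n,\lambda}=x(x+\lambda)\cdots(x+(n-1)\lambda)$ ($n\ge1$); $(x)_n=(x)_{n,1}$. Stirling numbers: $(x)_n=\sum_k S_1(n,k)x^k$, $x^n=\sum_k S_2(n,k)(x)_k$. Degenerate Stirling numbers of the first kind: $(x)_n=\sum_{l=0}^{n}S_{1,\lambda}(n,l)(x)_{l,\lambda}$. Degenerate Whitney numbers of the first kind $V_{m,\lambda}(n,k)$: $m^{n}(x)_{n}=\sum_{k=0}^{n}V_{m,\lambda}(n,k)(mx+1)_{k,\lambda}$. *)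

(* Defs.v *)
From mathcomp Require Import all_boot all_order all_algebra.
From mathcomp Require Import reals.
Set Implicit Arguments. Unset Strict Implicit. Unset Printing Implicit Defensive.
Import Order.TTheory GRing.Theory Num.Theory.
Local Open Scope ring_scope.

Section Definitions.
Variable R : realType.
Implicit Types (x lam : R) (n m : nat) (S V : nat -> nat -> R).

(* (x)_{n,lam} *)
Definition dfalling lam n x : R := \prod_(0 <= i < n) (x - i%:R * lam).

(* <x>_{n,lam} *)
Definition drising lam n x : R := \prod_(0 <= i < n) (x + i%:R * lam).

Definition falling n x : R := dfalling 1 n x.

(* Each of these expansions determines the entries (n, k) with k <= n uniquely
   (for m > 0 in the last one; see the [*_exists] and [*_unique] lemmas below)
   and leaves the entries with k > n unconstrained. *)
Definition is_stirling1 S : Prop :=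
  forall n x, falling n x = \sum_(0 <= k < n.+1) S n k * x ^+ k.

Definition is_stirling2 S : Prop :=
  forall n x, x ^+ n = \sum_(0 <= k < n.+1) S n k * falling k x.

Definition is_dstirling1 lam S : Prop :=
  forall n x, falling n x = \sum_(0 <= l < n.+1) S n l * dfalling lam l x.

Definition is_dwhitney1 m lam V : Prop :=
  forall n x, m%:R ^+ n * falling n x =
    \sum_(0 <= k < n.+1) V n k * dfalling lam k (m%:R * x + 1).

End Definitions.

Section WellDefined.
Variable R : realType.
Implicit Types (x lam : R) (n m : nat) (S V : nat -> nat -> R).

Let graded (f : nat -> R -> R) :=
  exists P : nat -> {poly R},
    forall n, size (P n) = n.+1 /\ (forall x, f n x = (P n).[x]).

Let graded_lin (c : nat -> R) (a b : R) : a != 0 ->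
  graded (fun n x => \prod_(0 <= i < n) (a * x + b - c i)).
Proof.
move=> a0; exists (fun n => \prod_(0 <= i < n) (a%:P * 'X + (b - c i)%:P)) => n.
split; last first.
  by move=> x; rewrite horner_prod; apply: eq_bigr => i _; rewrite !hornerE; rewrite ?addrA.
have sz d : size (a%:P * 'X + d%:P) = 2%N.
  by rewrite mul_polyC size_polyDl size_scale // ?size_polyX // ltnS size_polyC_leq1.
elim: n => [|n IH]; first by rewrite big_nil size_poly1.
rewrite big_nat_recr //= size_mul ?IH ?sz ?addn2 //.
  by rewrite -size_poly_gt0 IH.
by rewrite -size_poly_gt0 sz.
Qed.

Let graded_ext f g : (forall n x, f n x = g n x) -> graded f -> graded g.
Proof.
move=> e [P hP]; exists P => n; have [h1 h2] := hP n.
by split=> // x; rewrite -e.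
Qed.

Let graded_aff m lam : (0 < m)%N ->
  graded (fun n x => dfalling lam n (m%:R * x + 1)).
Proof. by move=> m0; apply: graded_lin; rewrite pnatr_eq0 -lt0n. Qed.

Let graded_df lam : graded (dfalling lam).
Proof.
apply: graded_ext (graded_lin (fun i => i%:R * lam) 0 (oner_neq0 R)) => n x.
by apply: eq_bigr => i _; rewrite mul1r addr0.
Qed.

Let graded_X : graded (fun n x => x ^+ n).
Proof.
by exists (fun n => 'X^n) => n; rewrite size_polyXn; split=> // x; rewrite hornerXn.
Qed.

Let expand (f : nat -> R -> R) n (p : {poly R}) : graded f ->
  (size p <= n)%N ->
  exists c : nat -> R, forall x, p.[x] = \sum_(0 <= k < n) c k * f k x.
Proof.
move=> [P hP]; elim: n p => [|n IH] p hp.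
  by exists (fun=> 0) => x; rewrite big_nil (size_poly_leq0P _ hp) horner0.
have [szP eP] := hP n.
have lP0 : (P n)`_n != 0.
  by have := lead_coef_eq0 (P n); rewrite lead_coefE szP /= => ->; rewrite -size_poly_gt0 szP.
set d := p`_n / (P n)`_n.
have /IH [c hc] : (size (p - d *: P n)%R <= n)%N.
  apply/leq_sizeP => j; rewrite leq_eqVlt coefB coefZ => /orP[/eqP <-|lj].
    by rewrite /d divfK // subrr.
  by rewrite !(nth_default 0) ?mulr0 ?subr0 ?szP // (leq_trans hp).
exists (fun k => if k == n then d else c k) => x.
rewrite big_nat_recr //= eqxx eP (_ : \sum_(0 <= k < n) _ = (p - d *: P n).[x]).
  by rewrite !hornerE subrK.
rewrite hc; apply: eq_big_nat => k /andP[_ lk].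
by rewrite (ltn_eqF lk).
Qed.

Let expand_uniq f n (c c' : nat -> R) : graded f ->
  (forall x, \sum_(0 <= k < n) c k * f k x = \sum_(0 <= k < n) c' k * f k x) ->
  forall k, (k < n)%N -> c k = c' k.
Proof.
move=> [P hP] e.
have {}e x : (\sum_(0 <= k < n) (c k - c' k) *: P k).[x] = 0.
  rewrite horner_sum; transitivity (\sum_(0 <= k < n) (c k * f k x - c' k * f k x)).
    by apply: eq_bigr => k _; rewrite hornerZ mulrBl (hP k).2.
  by rewrite sumrB e subrr.
have {}e : \sum_(0 <= k < n) (c k - c' k) *: P k = 0.
  set q := \sum_(_ <= _ < _) _ in e *.
  apply: (@roots_geq_poly_eq0 _ q [seq i%:R | i <- iota 0 (size q)]).
  - by apply/allP => y _; apply/rootP.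
  - by rewrite map_inj_uniq ?iota_uniq // => i j /eqP; rewrite eqr_nat => /eqP.
  - by rewrite size_map size_iota.
elim: n e => [//|n IH] e k; rewrite ltnS leq_eqVlt => hk.
have [szP _] := hP n.
have top : c n - c' n = 0.
  have := congr1 (fun q : {poly R} => q`_n) e.
  rewrite big_nat_recr //= coefD coef0 coefZ coef_sum big_nat big1 => [|i /andP[_ li]].
    have lP0 : (P n)`_n != 0.
      by have := lead_coef_eq0 (P n); rewrite lead_coefE szP /= => ->; rewrite -size_poly_gt0 szP.
    by rewrite add0r => /eqP; rewrite mulf_eq0 (negPf lP0) orbF => /eqP.
  by rewrite coefZ nth_default ?mulr0 // (hP i).1.
case/orP: hk => [/eqP ->|]; first by apply/eqP; rewrite -subr_eq0 top.
by apply: IH; move: e; rewrite big_nat_recr //= top scale0r addr0.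
Qed.

Let connect (g f : nat -> R -> R) : graded g -> graded f ->
  exists S, forall n x, g n x = \sum_(0 <= k < n.+1) S n k * f k x.
Proof.
move=> [Q hQ] gf.
have hc n := expand gf (eq_leq (hQ n).1).
exists (fun n => projT1 (boolp.cid (hc n))) => n x.
by case: boolp.cid => c /= <-; rewrite (hQ n).2.
Qed.

Let connect_uniq (g f : nat -> R -> R) S S' : graded f ->
  (forall n x, g n x = \sum_(0 <= k < n.+1) S n k * f k x) ->
  (forall n x, g n x = \sum_(0 <= k < n.+1) S' n k * f k x) ->
  forall n k, (k <= n)%N -> S n k = S' n k.
Proof.
move=> gf e e' n k hk; apply: (expand_uniq gf (n := n.+1)) => // x.
by rewrite -e -e'.
Qed.

Lemma stirling1_exists : exists S, @is_stirling1 R S.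
Proof. exact: (connect (graded_df 1) graded_X). Qed.

Lemma stirling1_unique S S' : is_stirling1 S -> is_stirling1 S' ->
  forall n k, (k <= n)%N -> S n k = S' n k.
Proof. by move=> h h'; apply: (connect_uniq _ h h'); apply: graded_X. Qed.

Lemma stirling2_exists : exists S, @is_stirling2 R S.
Proof. exact: (connect graded_X (graded_df 1)). Qed.

Lemma stirling2_unique S S' : is_stirling2 S -> is_stirling2 S' ->
  forall n k, (k <= n)%N -> S n k = S' n k.
Proof. by move=> h h'; apply: (connect_uniq _ h h'); apply: graded_df 1. Qed.

Lemma dstirling1_exists lam : exists S, is_dstirling1 lam S.
Proof. exact: (connect (graded_df 1) (graded_df lam)). Qed.

Lemma dstirling1_unique lam S S' : is_dstirling1 lam S -> is_dstirling1 lam S' ->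
  forall n k, (k <= n)%N -> S n k = S' n k.
Proof. by move=> h h'; apply: (connect_uniq _ h h'); apply: graded_df lam. Qed.

Lemma dwhitney1_exists m lam : (0 < m)%N -> exists V, is_dwhitney1 m lam V.
Proof.
move=> m0; apply: connect (graded_aff _ m0).
have m0' : m%:R != 0 :> R by rewrite pnatr_eq0 -lt0n.
apply: graded_ext (graded_lin (fun i => m%:R * i%:R) 0 m0') => n x.
elim: n => [|n IH]; first by rewrite /falling /dfalling !big_nil mul1r.
rewrite big_nat_recr //= IH /falling /dfalling [in RHS]big_nat_recr //=.
by rewrite addr0 mulr1 -mulrBr exprSr mulrACA.
Qed.

Lemma dwhitney1_unique m lam V V' : (0 < m)%N ->
  is_dwhitney1 m lam V -> is_dwhitney1 m lam V' ->
  forall n k, (k <= n)%N -> V n k = V' n k.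
Proof. by move=> m0 h h'; apply: (connect_uniq _ h h'); apply: graded_aff. Qed.

End WellDefined.

(* Main.v *)
(** Put y = m x. The powers y ^ j expand successively over falling factorials,
   degenerate falling factorials (y)_{l,lam}, and, by the degenerate
   Vandermonde convolution for y = (y + 1) + (-1), over (y + 1)_{k,lam}, where
   (-1)_{l-k,lam} = (-1)^(l-k) <1>_{l-k,lam}. Hence the right-hand side
   satisfies the expansion that determines the degenerate Whitney numbers. *)
Require Import Defs.
From mathcomp Require Import all_boot all_order all_algebra.
From mathcomp Require Import reals.
From mathcomp Require Import ring.
Import Order.TTheory GRing.Theory Num.Theory.
Local Open Scope ring_scope.

(** Serves to collect the coefficient of each basis element when one triangular expansion is
    substituted into another. *)
Lemma triangular_exchange (M : nmodType) (n : nat) (F : nat -> nat -> M) :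
  \sum_(0 <= j < n) \sum_(0 <= k < j.+1) F j k =
  \sum_(0 <= k < n) \sum_(k <= j < n) F j k.
Proof.
elim: n => [|n IH]; first by rewrite !big_nil.
rewrite big_nat_recr //= IH [in RHS]big_nat_recr //= big_nat1.
rewrite [in LHS]big_nat_recr //= addrA -big_split; congr (_ + _).
by apply: eq_big_nat => k /andP[_ kn]; rewrite [in RHS]big_nat_recr //= ltnW.
Qed.

Lemma dfallingS (R : realType) (lam : R) n x :
  dfalling lam n.+1 x = dfalling lam n x * (x - n%:R * lam).
Proof. by rewrite /dfalling big_nat_recr. Qed.

Lemma dfallingN (R : realType) (lam : R) n x :
  dfalling lam n (- x) = (-1) ^+ n * drising lam n x.
Proof.
rewrite /drising; elim: n => [|n IH]; first by rewrite /dfalling !big_nil mulr1.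
by rewrite dfallingS IH big_nat_recr //= exprS; ring.
Qed.

(** Induction on [n]: in the [k]-th term the new factor [x + y - n * lam] splits as
    [(x - k * lam) + (y - (n - k) * lam)], and Pascal's rule merges the two resulting sums. *)
Lemma dfallingD (R : realType) (lam : R) n x y :
  dfalling lam n (x + y) =
  \sum_(0 <= k < n.+1) 'C(n, k)%:R * dfalling lam k x * dfalling lam (n - k) y.
Proof.
elim: n => [|n IH]; first by rewrite big_nat1 /dfalling !big_nil !mul1r.
transitivity
    (\sum_(0 <= k < n.+1)
       'C(n, k)%:R * dfalling lam k x * dfalling lam (n.+1 - k) y +
     \sum_(0 <= k < n.+1)
       'C(n, k)%:R * dfalling lam k.+1 x * dfalling lam (n - k) y).
  rewrite dfallingS IH mulr_suml -big_split; apply: eq_big_nat => k /andP[_ kn].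
  by rewrite /= subSn // !dfallingS natrB //; ring.
rewrite [in RHS]big_nat_recl // [in LHS]big_nat_recl //= !bin0 -addrA.
congr (_ + _); under [in RHS]eq_bigr do rewrite binS natrD !mulrDl subSS.
rewrite big_split /=; congr (_ + _).
(* The sum from Pascal's rule has one more term, whose coefficient ['C(n, n.+1)] is zero. *)
by rewrite [in RHS]big_nat_recr //= bin_small // !mul0r addr0.
Qed.

(** The inner sum is an entry of the product of two triangular change-of-basis matrices. *)
Lemma expr_dfalling {R : realType} {lam : R} {S2 S1lam : nat -> nat -> R} :
  is_stirling2 S2 -> is_dstirling1 lam S1lam -> forall j y,
  y ^+ j = \sum_(0 <= l < j.+1)
    (\sum_(l <= i < j.+1) S1lam i l * S2 j i) * dfalling lam l y.
Proof.
move=> hS2 hS1lam j y; rewrite hS2.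
under eq_bigr do rewrite hS1lam mulr_sumr.
rewrite triangular_exchange; apply: eq_bigr => l _.
by rewrite mulr_suml; apply: eq_bigr => i _; ring.
Qed.

Lemma dfalling_add1 (R : realType) (lam : R) l y :
  dfalling lam l y = \sum_(0 <= k < l.+1)
    'C(l, k)%:R * (-1) ^+ (l - k) * drising lam (l - k) 1
    * dfalling lam k (y + 1).
Proof.
rewrite -{1}[y](addrK 1) dfallingD.
by apply: eq_bigr => k _; rewrite dfallingN; ring.
Qed.

Theorem theorem8 (R : realType) (m : nat) (lam : R)
    (S1 S2 S1lam V : nat -> nat -> R)
    (hm : (0 < m)%N) (hlam : lam != 0)
    (hS1 : is_stirling1 S1) (hS2 : is_stirling2 S2)
    (hS1lam : is_dstirling1 lam S1lam) (hV : is_dwhitney1 m lam V)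
    (n k : nat) (hkn : (k <= n)%N) :
  V n k =
    \sum_(k <= j < n.+1) \sum_(k <= l < j.+1)
      'C(l, k)%:R * (-1) ^+ (l - k) * drising lam (l - k) 1
      * (\sum_(l <= i < j.+1) S1lam i l * S2 j i)
      * S1 n j * m%:R ^+ (n - j).
Proof.
pose W n k : R := \sum_(k <= j < n.+1) \sum_(k <= l < j.+1)
  'C(l, k)%:R * (-1) ^+ (l - k) * drising lam (l - k) 1
  * (\sum_(l <= i < j.+1) S1lam i l * S2 j i) * S1 n j * m%:R ^+ (n - j).
suff hW : is_dwhitney1 m lam W by exact: (dwhitney1_unique hm hV hW).
move=> {hkn k} {}n x.
under [RHS]eq_bigr do rewrite mulr_suml.
(* With [j] outermost, both sides are compared term by term along the expansion of [falling n x] in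
   powers. *)
rewrite -triangular_exchange hS1 mulr_sumr.
apply: eq_big_nat => j /andP[_ jn].
(* Since [j <= n], a factor [m ^ j] can be absorbed into [(m * x) ^ j]. *)
have -> : m%:R ^+ n * (S1 n j * x ^+ j)
    = S1 n j * m%:R ^+ (n - j) * (m%:R * x) ^+ j.
  by rewrite -{1}(subnK (m := j) (n := n)) // exprD exprMn; ring.
rewrite (expr_dfalling hS2 hS1lam j (_ * x)).
under [in LHS]eq_bigr do rewrite dfalling_add1 mulr_sumr.
(* This exchange puts [k] outside [l], the order of summation in [W]. *)
rewrite triangular_exchange mulr_sumr; apply: eq_bigr => k _.
by rewrite mulr_sumr mulr_suml; apply: eq_bigr => l _; ring.
Qed.
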